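(* Let $S_0,S_1,\ldots,S_i,\ldots$ be a fuzzy linguistic resolution $\alpha$-strategy derivation. Then $S_n$ contains the empty clause for some $n\in\{0,1,\ldots\}$ if and only if $S_0$ is unsatisfiable.
   Context: Truth domain: a linear symmetrical hedge algebra $AX=(X,G,H,\le)$ with $G=\{\bot,\mathsf{False},\mathsf{W},\mathsf{True},\top\}$, $\bot<\mathsf{False}<\mathsf{W}<\mathsf{True}<\top$ ($\bot,\mathsf{W},\top$ least, neutral, greatest), hedges $H=H^+\cup H^-$ (each part linearly ordered), $X$ the finite linearly ordered set of terms $h_n\cdots h_1a$. For $x=h_n\cdots h_1a$ with $a\in\{\mathsf{True},\mathsf{False}\}$, $\overline{x}=h_n\cdots h_1a'$ with $a'$ the other of $\mathsf{True},\mathsf{False}$. Operations: $\alpha\wedge\beta=\min$, $\alpha\vee\beta=\max$, $\neg\alpha=\overline\alpha$. A literal is $A^\alpha$ with $A$ an atom (propositional variable or constant) and $\alpha\in X$; a clause is a finite disjunction of literals; $\Box$ is the empty clause, which is false under every interpretation. An interpretation $I$ assigns each atom $A$ a value $I(A)\in X$; if $I(A)=\alpha_1$: $I(A^{\alpha_2})=\alpha_1\wedge\alpha_2$ if $\alpha_1,\alpha_2>\mathsf{W}$; $=\neg(\alpha_1\vee\alpha_2)$ if $\alpha_1,\alpha_2\le\mathsf{W}$; $=(\neg\alpha_1)\vee\alpha_2$ if $\alpha_1>\mathsf{W}\ge\alpha_2$; $=\alpha_1\vee(\neg\alpha_2)$ if $\alpha_1\le\mathsf{W}<\alpha_2$;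 $I(P\vee Q)=I(P)\vee I(Q)$, $I(P\wedge Q)=I(P)\wedge I(Q)$. A formula $F$ is unsatisfiable iff $I(F)\le\mathsf{W}$ for every interpretation $I$; a set of clauses (with reliabilities) is unsatisfiable iff the conjunction of its clauses is. A clause with reliability is a pair $(C,\alpha)$ with $C$ a clause and $\alpha\in X$, $\alpha>\mathsf{W}$; $(C,\alpha)$ and $(C,\alpha')$ are called variants. Fuzzy linguistic resolution rule: from $(A^a\vee B^{b_1},\alpha_1)$ and $(B^{b_2}\vee C^c,\alpha_2)$, where $B$ is an atom occurring in both, $b_1\wedge b_2\le\mathsf{W}$ and $b_1\vee b_2>\mathsf{W}$, infer $(A^a\vee C^c,\alpha_3)$ with $\alpha_3=\alpha_1\wedge\alpha_2\wedge\neg(b_1\wedge b_2)\wedge(b_1\vee b_2)$; here $A^a$ and $C^c$ stand for the remaining (possibly empty) disjunctions of literals of the premises. An $\alpha$-strategy derivation is a sequence $S_0,S_1,\ldots$ of sets of clauses with reliability such that each $S_{i+1}$ is obtained from $S_i$ either (a) as $S_i\cup\{(C,\alpha)\}$ where $(C,\alpha)$ is the conclusion of a resolution inference with premises $(C_1,\alpha_1),(C_2,\alpha_2)\in S_i$ such that there are no $(C_1,\alpha_1'),(C_2,\alpha_2')\in S_i$ with $\alpha_1'>\alpha_1$ and $\alpha_2'>\alpha_2$; or (b) as $S_i\setminus\{(C,\alpha)\}$ where $(C,\alpha)\in S_i$ and some $(C,\alpha')\in S_i$ has $\alpha<\alpha'$.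
   Formalization: The ''if'' direction (S_0 unsatisfiable implies the empty clause occurs) is false for arbitrary derivations, so it is proved for fair ones (no permanently admissible inference is ignored forever) with no literal of S_0 labelled W; the ''only if'' direction is proved for all derivations. *)

(* Defs.v *)
From HB Require Import structures.
From mathcomp Require Import all_boot all_order.
From mathcomp Require Import finmap.
From mathcomp Require Import boolp classical_sets.

Set Implicit Arguments.
Unset Strict Implicit.
Unset Printing Implicit Defensive.

Import Order.Theory.

Local Open Scope order_scope.

Section Hedges.
Context (d : Order.disp_t) (X : finTBOrderType d) (H : Type).
Variable app : H -> X -> X.

(* [hterm [:: h_n; ...; h_1] a] is h_n ... h_1 a. *)
Definition hterm (s : seq H) (a : X) : X := foldr app a s.

(* y \in H(x) *)
Definition generated_by (x y : X) : Prop := exists s, y = hterm s x.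

Definition at_least_as_strong (h k : H) : Prop :=
  forall x, (x <= app k x <= app h x) \/ (app h x <= app k x <= x).

Definition converse_hedges (h k : H) : Prop :=
  forall x, (x <= app h x) = (app k x <= x) /\ (app h x <= x) = (x <= app k x).

Definition positive_wrt (h k : H) : Prop :=
  forall x, (x <= app k x <= app h (app k x)) \/
            (app h (app k x) <= app k x <= x).

Definition negative_wrt (h k : H) : Prop :=
  forall x, ((x <= app k x) && (app h (app k x) <= app k x)) \/
            ((app k x <= x) && (app k x <= app h (app k x))).

End Hedges.

(* Linear symmetrical hedge algebra on a finite chain X whose hedges are the
   disjoint union Hp + Hm of two chains.  The axioms are those of hedge algebras
   (Ho and Wechler) for a linear order; the incomparability clauses are void.
   A finite X is obtained by bounding the number of hedges in a term: the terms
   of maximal length are fixed points of every hedge. *)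
Record lsha (d : Order.disp_t) (X : finTBOrderType d)
    (dp : Order.disp_t) (Hp : orderType dp)
    (dm : Order.disp_t) (Hm : orderType dm) := LSHA {
  happ : Hp + Hm -> X -> X;
  vFalse : X;
  vW : X;
  vTrue : X;
  hneg : X -> X;
  lsha_gen_lt : [&& \bot < vFalse, vFalse < vW, vW < vTrue & vTrue < \top];
  lsha_fix : forall h, [/\ happ h \bot = \bot, happ h vW = vW
                         & happ h \top = \top];
  lsha_gen : forall x, [\/ x \in [:: \bot; vW; \top],
                          generated_by happ vFalse x
                        | generated_by happ vTrue x];
  lsha_neutral : forall s, hterm happ s vFalse < vW < hterm happ s vTrue;
  (* The order of each of the two chains of hedges is the order of strength. *)
  lsha_strength_p : forall h k : Hp, k <= h ->
    at_least_as_strong happ (inl h) (inl k);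
  lsha_strength_m : forall h k : Hm, k <= h ->
    at_least_as_strong happ (inr h) (inr k);
  lsha_converse : forall (h : Hp) (k : Hm),
    converse_hedges happ (inl h) (inr k);
  lsha_sign : forall h k, positive_wrt happ h k \/ negative_wrt happ h k;
  lsha_indep : forall u v x, ~ generated_by happ v u -> ~ generated_by happ u v ->
    generated_by happ u x -> ~ generated_by happ v x;
  lsha_acyclic : forall h x, happ h x <> x -> ~ generated_by happ (happ h x) x;
  lsha_inherit : forall h k h' k' x, h <> k -> happ h x <= happ k x ->
    happ h' (happ h x) <= happ k' (happ k x);
  lsha_split : forall h k x, happ h x <> happ k x ->
    ~ generated_by happ (happ k x) (happ h x);
  lsha_stable_le : forall h u v, ~ generated_by happ v u -> u <= v ->
    u <= happ h v;
  lsha_stable_ge : forall h u v, ~ generated_by happ v u -> v <= u ->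
    happ h v <= u;
  (* [hneg] is x |-> \overline{x}.  Its well-definedness on terms is the symmetry
     of the algebra; on the constants it has the usual values. *)
  lsha_negT : forall s, hneg (hterm happ s vTrue) = hterm happ s vFalse;
  lsha_negF : forall s, hneg (hterm happ s vFalse) = hterm happ s vTrue;
  lsha_negB : [/\ hneg \bot = \top, hneg \top = \bot & hneg vW = vW]
}.

Section Resolution.
Context (d : Order.disp_t) (X : finTBOrderType d).
Context (dp : Order.disp_t) (Hp : orderType dp).
Context (dm : Order.disp_t) (Hm : orderType dm).
Variables (AX : lsha X Hp Hm) (atom : choiceType).

Local Notation W := (vW AX).
Local Notation neg := (hneg AX).

Definition literal : choiceType := (atom * X)%type.

(* Disjunctions are taken up to associativity, commutativity and idempotence;
   the empty clause is [fset0]. *)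
Definition clause : choiceType := {fset literal}.

(* A clause with its reliability. *)
Definition rclause : choiceType := (clause * X)%type.

Definition eval_literal (I : atom -> X) (L : literal) : X :=
  let a1 := I L.1 in let a2 := L.2 in
  if W < a1 then (if W < a2 then Order.min a1 a2 else Order.max (neg a1) a2)
  else (if W < a2 then Order.max a1 (neg a2) else neg (Order.max a1 a2)).

Definition eval_clause (I : atom -> X) (C : clause) : X :=
  \big[Order.max / \bot]_(L <- enum_fset C) eval_literal I L.

(* The conjunction of S, which may be infinite: the minimum of the values taken
   by the clauses of S, all of which lie in the finite chain X. *)
Definition eval_set (I : atom -> X) (S : set rclause) : X :=
  \big[Order.min / \top]_(v : X | `[< exists2 P, S P & eval_clause I P.1 = v >]) v.

Definition unsatisfiable (S : set rclause) : Prop :=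
  forall I : atom -> X, eval_set I S <= W.

(* Q is inferred from P1 and P2. *)
Definition resolvent (P1 P2 Q : rclause) : Prop :=
  exists (B : atom) (b1 b2 : X),
    [/\ (B, b1) \in P1.1 /\ (B, b2) \in P2.1,
        Order.min b1 b2 <= W,
        W < Order.max b1 b2,
        Q.1 = ((P1.1 `\ (B, b1)) `|` (P2.1 `\ (B, b2)))%fset
      & Q.2 = Order.min (Order.min (Order.min P1.2 P2.2)
                (neg (Order.min b1 b2))) (Order.max b1 b2)].

Definition alpha_inference (S : set rclause) (P1 P2 Q : rclause) : Prop :=
  [/\ S P1, S P2, resolvent P1 P2 Q
    & ~ exists a1 a2 : X, [/\ S (P1.1, a1), S (P2.1, a2), P1.2 < a1 & P2.2 < a2]].

Definition alpha_step (S S' : set rclause) : Prop :=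
  (exists P1 P2 Q, alpha_inference S P1 P2 Q /\ S' = (S `|` [set Q])%classic) \/
  (exists C a a', [/\ S (C, a), S (C, a'), a < a'
                    & S' = (S `\` [set (C, a)])%classic]).

(* Derivations may be finite or infinite: S_0, ..., S_m for [len = Some m],
   S_0, S_1, ... for [len = None]. *)
Definition in_range (len : option nat) (i : nat) : Prop :=
  if len is Some m then (i <= m)%N else True.

Definition alpha_derivation (len : option nat) (S : nat -> set rclause) : Prop :=
  (forall i, in_range len i -> forall P, S i P -> W < P.2) /\
  (forall i, in_range len i.+1 -> alpha_step (S i) (S i.+1)).

(* No inference is postponed forever: if from some stage on an inference is
   permanently admissible, then its conclusion, or a variant of it, occurs in the
   derivation.  A finite derivation is fair when its last set is saturated. *)
Definition fair (len : option nat) (S : nat -> set rclause) : Prop :=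
  forall i P1 P2 Q, in_range len i ->
    (forall j, (i <= j)%N -> in_range len j -> alpha_inference (S j) P1 P2 Q) ->
    exists j a, in_range len j /\ S j (Q.1, a).

(* A^W has value at most W under every interpretation, although no resolution
   inference refutes it; and resolving upon it would produce the reliability W,
   which is not a legal one. *)
Definition no_neutral_literal (S : set rclause) : Prop :=
  forall P L, S P -> L \in P.1 -> L.2 <> W.

Definition has_empty_clause (S : set rclause) : Prop :=
  exists a, S ((fset0 : clause), a).

End Resolution.

(* Main.v *)
(* A literal A^a with a > W (resp. a < W) exceeds W exactly when A does (resp.
   when A lies below W), so that satisfiability is a two-valued matter and
   soundness is immediate.  For completeness, let N be the set of all clauses of
   the derivation.  A variant of maximal reliability is never deleted, hence
   fairness makes N closed under resolution.  If the empty clause is not in N,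
   Zorn's lemma gives a maximal set F of literals including no clause of N.  Of
   two literals that can be resolved upon one is in F: otherwise maximality gives
   clauses of N included in F but for these literals, whose resolvent is included
   in F.  So the literals outside F can be made true simultaneously, and each
   clause of N has one. *)

Require Import Defs.
From mathcomp Require Import all_boot all_order finmap boolp classical_sets.

Set Implicit Arguments.
Unset Strict Implicit.
Unset Printing Implicit Defensive.

Import Order.Theory.

Section Negation.
Local Open Scope order_scope.
Context (d : Order.disp_t) (X : finTBOrderType d).
Context (dp : Order.disp_t) (Hp : orderType dp).
Context (dm : Order.disp_t) (Hm : orderType dm).
Variable AX : lsha X Hp Hm.
Local Notation W := (vW AX).
Local Notation neg := (hneg AX).

Lemma bot_lt_vW : \bot < W.
Proof. by case/and4P: (lsha_gen_lt AX) => bF FW _ _; exact: lt_trans FW. Qed.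

Lemma vW_lt_top : W < \top.
Proof. by case/and4P: (lsha_gen_lt AX) => _ _ WT; exact: lt_trans. Qed.

(** Negation swaps the terms over [vFalse] with those over [vTrue], which lie on opposite sides of
    W; the three constants are checked directly. *)
Lemma hneg_compare x :
  [\/ [/\ x < W & W < neg x], x = W /\ neg x = W | [/\ W < x & neg x < W]].
Proof.
have [nb nt nW] := lsha_negB AX.
case: (lsha_gen AX x) => [|[s ->]|[s ->]].
- rewrite !inE => /or3P[]/eqP->; rewrite ?nb ?nt ?nW ?bot_lt_vW ?vW_lt_top.
  + by constructor 1.
  + by constructor 2.
  + by constructor 3.
- by rewrite lsha_negF; case/andP: (lsha_neutral AX s); constructor 1.
- by rewrite lsha_negT; case/andP: (lsha_neutral AX s); constructor 3.
Qed.

Lemma gt_vW_hneg x : (W < neg x) = (x < W).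
Proof.
case: (hneg_compare x) => [[-> ->]|[-> ->]|[xW nW]] //.
by rewrite !ltNge !ltW.
Qed.

End Negation.

Section Semantics.
Local Open Scope order_scope.
Context (d : Order.disp_t) (X : finTBOrderType d).
Context (dp : Order.disp_t) (Hp : orderType dp).
Context (dm : Order.disp_t) (Hm : orderType dm).
Variables (AX : lsha X Hp Hm) (atom : choiceType).
Local Notation W := (vW AX).

Lemma eval_literal_gt_vW (I : atom -> X) (L : literal X atom) :
  (W < eval_literal AX I L) =
    if W < L.2 then W < I L.1 else (I L.1 < W) && (L.2 < W).
Proof.
rewrite /eval_literal.
case: (ltP W (I L.1)) => WI; case: (ltP W L.2) => WL.
- by rewrite lt_min WI.
- by rewrite lt_max gt_vW_hneg !ltNge WL (ltW WI).
- by rewrite lt_max gt_vW_hneg !ltNge WI (ltW WL).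
- by rewrite gt_vW_hneg gt_max.
Qed.

Lemma eval_clause_gt_vW (I : atom -> X) (C : clause X atom) :
  W < eval_clause AX I C <-> exists2 L, L \in C & W < eval_literal AX I L.
Proof.
suff -> : (W < eval_clause AX I C) =
    has (fun L => W < eval_literal AX I L) (enum_fset C).
  by split=> /hasP.
rewrite /eval_clause; elim: (enum_fset C) => [|L s IH] /=.
  by rewrite big_nil ltx0.
by rewrite big_cons lt_max IH.
Qed.

Lemma eval_set_gt_vW (I : atom -> X) (S : set (rclause X atom)) :
  W < eval_set AX I S <-> forall P, S P -> W < eval_clause AX I P.1.
Proof.
split=> [WS P SP|WS].
- apply: lt_le_trans WS _; apply: bigmin_le_cond.
  by apply/asboolP; exists P.
- apply: lt_bigmin; first exact: vW_lt_top.
  by move=> v /asboolP[P SP <-]; exact: WS.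
Qed.

Lemma resolvent_sound (I : atom -> X) (P1 P2 Q : rclause X atom) :
  resolvent AX P1 P2 Q ->
  W < eval_clause AX I P1.1 -> W < eval_clause AX I P2.1 ->
  W < eval_clause AX I Q.1.
Proof.
case=> B [b1 [b2 [_ minW maxW -> _]]].
move=> /eval_clause_gt_vW[L1 L1P tL1] /eval_clause_gt_vW[L2 L2P tL2].
apply/eval_clause_gt_vW.
have [eL1|nL1] := eqVneq L1 (B, b1); last first.
  by exists L1 => //; rewrite !inE L1P nL1.
have [eL2|nL2] := eqVneq L2 (B, b2); last first.
  by exists L2 => //; rewrite !inE L2P nL2 orbT.
move: tL1 tL2 minW maxW; rewrite eL1 eL2 !eval_literal_gt_vW ge_min lt_max /=.
(* Only labels on opposite sides of W survive, and then [I B] would have to be both above and below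
   W. *)
by case: (ltP W b1); case: (ltP W b2) => //= _ _; case: ltgtP.
Qed.

(** Reliabilities are dropped, and the premise with the positive label comes first: the other order
    gives the same union. *)
Definition resolution_closed (N : set (clause X atom)) :=
  forall C1 C2 B b1 b2, N C1 -> N C2 -> (B, b1) \in C1 -> (B, b2) \in C2 ->
    b2 < W < b1 -> N ((C1 `\ (B, b1)) `|` (C2 `\ (B, b2)))%fset.

Lemma resolution_closed_model (N : set (clause X atom)) :
  resolution_closed N -> ~ N fset0 ->
  (forall C L, N C -> L \in C -> L.2 <> W) ->
  exists I : atom -> X, forall C, N C -> W < eval_clause AX I C.
Proof.
move=> Ncl N0 NW.
pose free (F : set (literal X atom)) :=
  forall C, N C -> exists2 L, L \in C & ~ F L.
have [|F [freeF maxF]] := @Zorn_bigcup _ (free : set (set _)).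
  move=> G Gfree Gtot C NC; apply: contrapT => Csub.
  have {}Csub L : L \in C -> exists2 F, G F & F L.
    by move=> LC; apply: contrapT => nGL; apply: Csub; exists L.
  (* A finite part of the union of a chain lies in one member. The chain may be empty, so [s] must
     not be; clauses of [N] qualify by [N0]. *)
  have Csub_chain (s : seq (literal X atom)) : s != [::] ->
      (forall L, L \in s -> exists2 F, G F & F L) ->
      exists2 F, G F & forall L, L \in s -> F L.
    elim: s => // L s IH _ sG.
    have [F1 GF1 F1L] := sG L (mem_head _ _).
    have [->|s0] := eqVneq s [::].
      by exists F1 => // M; rewrite inE => /eqP->.
    have [|F2 GF2 F2s] := IH s0.
      by move=> M Ms; apply: sG; rewrite inE Ms orbT.
    have [F12|F21] := Gtot _ _ GF1 GF2.
    - exists F2 => // M; rewrite inE => /predU1P[->|/F2s//]; exact: F12.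
    - exists F1 => // M; rewrite inE => /predU1P[->//|/F2s]; exact: F21.
  have [||F GF FC] := Csub_chain (enum_fset C); last 2 first.
  - exact: Csub.
  - by have [L /FC LF nFL] := Gfree _ GF _ NC; apply: nFL.
  apply/eqP => C0; apply: N0; suff <- : C = fset0 by [].
  by apply/fsetP => L; rewrite -[LHS]/(L \in enum_fset C) C0.
have maxF_clause L : ~ F L ->
    exists2 C, N C & forall M, M \in C -> M <> L -> F M.
  move=> nFL; apply: contrapT => noC.
  (* If no clause of [N] lay in [F] with [L] added, this larger set would still be free. *)
  apply: (maxF (fun M => F M \/ M = L)).
    split; first by left.
    by move=> /(_ L (or_intror erefl)).
  move=> C NC; apply: contrapT => Csub; apply: noC; exists C => // M MC ML.
  by apply: contrapT => nFM; apply: Csub; exists M => // -[].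
have F_conflict B b1 b2 : b2 < W < b1 -> F (B, b1) \/ F (B, b2).
  move=> b21; apply: contrapT => /not_orP[nF1 nF2].
  have [C1 NC1 FC1] := maxF_clause _ nF1.
  have [C2 NC2 FC2] := maxF_clause _ nF2.
  (* Otherwise all of [C1] would lie in [F]. *)
  have LC1 : (B, b1) \in C1.
    apply: contrapT => nC1; have [L LC1 nFL] := freeF _ NC1.
    by apply: nFL; apply: FC1 => // eL; apply: nC1; rewrite -eL.
  have LC2 : (B, b2) \in C2.
    apply: contrapT => nC2; have [L LC2 nFL] := freeF _ NC2.
    by apply: nFL; apply: FC2 => // eL; apply: nC2; rewrite -eL.
  have [L] := freeF _ (Ncl _ _ _ _ _ NC1 NC2 LC1 LC2 b21).
  by rewrite !inE => /orP[]/andP[/eqP nL LC] []; [exact: FC1|exact: FC2].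
(* No atom gets the value W. The default [\bot] makes negative literals true; by [F_conflict], an
   atom with a negative literal outside [F] always gets it. *)
pose I B : X := if `[< exists2 b, W < b & ~ F (B, b) >] then \top else \bot.
exists I => C NC; apply/eval_clause_gt_vW.
have [[B b] LC nFL] := freeF _ NC; exists (B, b) => //.
rewrite eval_literal_gt_vW /= /I.
case: (ltgtP W b) => [Wb|bW|Wb]; last by case: (NW _ _ NC LC).
- case: asboolP => [_|]; first exact: vW_lt_top.
  by case; exists b.
- case: asboolP => [[b1 Wb1 nF1]|_]; last by rewrite bot_lt_vW.
  by case: (F_conflict B b1 b); rewrite ?bW.
Qed.

End Semantics.

Section Derivations.
Local Open Scope order_scope.
Context (d : Order.disp_t) (X : finTBOrderType d).
Context (dp : Order.disp_t) (Hp : orderType dp).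
Context (dm : Order.disp_t) (Hm : orderType dm).
Variables (AX : lsha X Hp Hm) (atom : choiceType).
Variables (len : option nat) (S : nat -> set (rclause X atom)).
Hypothesis step : forall i, in_range len i.+1 -> alpha_step AX (S i) (S i.+1).
Local Notation W := (vW AX).

Lemma in_range_le i j : (i <= j)%N -> in_range len j -> in_range len i.
Proof. by case: len => //= m; exact: leq_trans. Qed.

Lemma derivation_ind (T : set (rclause X atom) -> Prop) i :
  (forall S1 S2, alpha_step AX S1 S2 -> T S1 -> T S2) -> T (S i) ->
  forall j, (i <= j)%N -> in_range len j -> T (S j).
Proof.
move=> stepT Ti; elim=> [|j IH]; first by rewrite leqn0 => /eqP<-.
rewrite leq_eqVlt => /predU1P[<- //|]; rewrite ltnS => ij rj.
by apply: stepT (step rj) _; apply: IH => //; exact: in_range_le rj.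
Qed.

Lemma derivation_sound (I : atom -> X) n : in_range len n ->
  W < eval_set AX I (S 0) -> W < eval_set AX I (S n).
Proof.
move=> rn I0.
apply: (derivation_ind (T := fun S' => W < eval_set AX I S') _ I0) => // S1 S2 st.
move=> /eval_set_gt_vW IS1; apply/eval_set_gt_vW => P.
case: st => [[P1 [P2 [Q [[SP1 SP2 res _] ->]]]]|[C [a [a' [_ _ _ ->]]]]].
- by case=> [/IS1 //|->]; apply: resolvent_sound res _ _; exact: IS1.
- by case=> /IS1.
Qed.

Lemma derivation_no_neutral n : in_range len n ->
  no_neutral_literal AX (S 0) -> no_neutral_literal AX (S n).
Proof.
move=> rn S0; apply: (derivation_ind _ S0) => // S1 S2 st nS1 P L.
case: st => [[P1 [P2 [Q [[SP1 SP2 [B [b1 [b2 [_ _ _ eQ _]]]] _] ->]]]]|].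
- case=> [/nS1|->]; first exact.
  by rewrite eQ !inE => /orP[]/andP[_]; exact: nS1.
- by move=> [C [a [a' [_ _ _ ->]]]] [/nS1 nP _]; exact: nP.
Qed.

Definition derived : set (clause X atom) :=
  fun C => exists j a, in_range len j /\ S j (C, a).

(** Since [X] is finite, some reliability is the largest that [C] has at any stage; deleting that
    variant would require a better one. *)
Lemma derived_max_persistent C : derived C ->
  exists i a, in_range len i /\
    forall j, (i <= j)%N -> in_range len j ->
      S j (C, a) /\ ~ exists2 a', S j (C, a') & a < a'.
Proof.
case=> j0 [a0 [rj0 Sj0]].
pose occurs v := `[< exists2 j, in_range len j & S j (C, v) >].
have occ0 : occurs a0 by apply/asboolP; exists j0.
case: (arg_maxP id occ0) => a /asboolP[i ri Sia] amax.
have a_max j a' : in_range len j -> S j (C, a') -> a' <= a.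
  by move=> rj Sj; apply: amax; apply/asboolP; exists j.
exists i, a; split=> // j ij rj; split; last first.
  by case=> a' /(a_max _ _ rj); rewrite leNgt => /negP.
elim: j ij rj => [|j IH]; first by rewrite leqn0 => /eqP<-.
rewrite leq_eqVlt => /predU1P[<- //|]; rewrite ltnS => ij rj.
have rj' : in_range len j by exact: in_range_le rj.
case: (step rj) => [[P1 [P2 [Q [_ ->]]]]|[C' [b [b' [_ Sb' bb' ->]]]]].
- by left; exact: IH.
- split; first exact: IH.
  move=> [eC eb]; subst C' b.
  by move: (a_max _ _ rj' Sb'); rewrite leNgt bb'.
Qed.

Lemma fair_derived_closed : fair AX len S -> resolution_closed AX derived.
Proof.
move=> fairS C1 C2 B b1 b2 /derived_max_persistent[i1 [a1 [r1 max1]]].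
move=> /derived_max_persistent[i2 [a2 [r2 max2]]] LC1 LC2 /andP[b2W Wb1].
pose Q : rclause X atom := (((C1 `\ (B, b1)) `|` (C2 `\ (B, b2)))%fset,
  Order.min (Order.min (Order.min a1 a2) (hneg AX (Order.min b1 b2)))
    (Order.max b1 b2)).
(* From this stage on both best variants are present, so the inference stays admissible. *)
apply: (fairS (maxn i1 i2) (C1, a1) (C2, a2) Q).
  by case/orP: (leq_total i1 i2) => [/maxn_idPr->|/maxn_idPl->].
move=> j; rewrite geq_max => /andP[ij1 ij2] rj.
have [S1 nS1] := max1 j ij1 rj; have [S2 _] := max2 j ij2 rj.
split=> //.
- exists B, b1, b2; split=> //; first by rewrite ge_min (ltW b2W) orbT.
  by rewrite lt_max Wb1.
(* The strategy blocks an inference only if both premises have better variants, so the maximality of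
   [a1] suffices. *)
- by case=> a1' [a2' [S1' _ lt1 _]]; apply: nS1; exists a1'.
Qed.

End Derivations.

(* The implication from left to right holds for every derivation; the converse
   needs that the derivation is fair and that no literal is labelled W. *)
Theorem theorem2 (d : Order.disp_t) (X : finTBOrderType d)
    (dp : Order.disp_t) (Hp : orderType dp)
    (dm : Order.disp_t) (Hm : orderType dm)
    (AX : lsha X Hp Hm) (atom : choiceType)
    (len : option nat) (S : nat -> set (rclause X atom)) :
  alpha_derivation AX len S ->
  ((exists n, in_range len n /\ has_empty_clause (S n)) ->
     unsatisfiable AX (S 0)) /\
  (fair AX len S -> no_neutral_literal AX (S 0) ->
     unsatisfiable AX (S 0) ->
     exists n, in_range len n /\ has_empty_clause (S n)).
Proof.
case=> _ step; split=> [[n [rn [a Sn0]]] I|fairS nS0 unsat].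
- rewrite leNgt; apply/negP => /(derivation_sound step rn)/eval_set_gt_vW.
  by move=> /(_ _ Sn0)/eval_clause_gt_vW[L]; rewrite inE.
- apply: contrapT => noempty.
  have [|C L [j [a [rj SjC]]]|I modelI] :=
      resolution_closed_model (fair_derived_closed step fairS).
  + by case=> j [a [rj Sj]]; apply: noempty; exists j; split=> //; exists a.
  + by move=> LC; exact: (derivation_no_neutral step rj nS0 SjC).
  have r0 : in_range len 0 by case: (len).
  have := unsat I; rewrite leNgt => /negP; apply; apply/eval_set_gt_vW.
  (* The initial clauses are derived at stage 0, so the model of all derived clauses satisfies
     [S 0]. *)
  by move=> [C a] SC; apply: modelI; exists 0, a.
Qed.
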